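(* For a partition $\lambda$ of length $\ell$ and $b=(b_1,\dots,b_\ell)\in B(\lambda_1)\otimes\cdots\otimes B(\lambda_\ell)$, $$\mathrm{zmaj}(b)=\mathrm{cocharge}\bigl(\mathfrak c(f_b)_0\bigr),$$ where $f_b$ is the tabloid of shape $\lambda$ whose $i$-th row (from the bottom) is $b_i$, $\mathfrak c$ is the companion map and the subscript $0$ denotes faithful recoloring.
   Context: An element of $B(\lambda_1)\otimes\cdots\otimes B(\lambda_\ell)$ is a tuple $b=(b_1,\dots,b_\ell)$ where $b_i$ is a weakly increasing word of length $\lambda_i$ in positive integers $\le n=|\lambda|$. Rows of shapes are counted upward from the bottom, columns from left to right. A tabloid is a filling whose rows weakly increase from left to right. $\lambda'_c=\#\{r:\lambda_r\ge c\}$. zmaj. $\mathrm{zmaj}(b)=\sum_{w\in Z(b)}\mathrm{maj}(w)$, where $Z(b)$ is the following collection (with multiplicity) of $\lambda_1$ words. The first word $w=w_{\lambda_1'}\cdots w_1$: $w_1$ is the smallest entry of $b_1$; iteratively, $w_i$ is the smallest entry of $b_i$ that is larger than $w_{i-1}$, or, if there is none, the smallest entry of $b_i$. The remaining words are constructed by the same process, ignoring previously selected letters (so the $k$-th word has length $\lambda_k'$, with letters selected from $b_1,\dots,b_{\lambda'_k}$). For a word $w=w_m\cdots w_1$, $\mathrm{maj}(w)=\sum_{j:\,w_{j+1}>w_j}(m-j)$. Colored tabloids. Colored letters $x_y$ are positive integers $x$ (letters) with positive integer subscripts $y$ (colors). Prismatic order: $u_v>r_c$ iff $r<u$, or $r=u$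 and $c>v$. A colored tabloid of weight $\lambda$ and shape $\gamma$ (a composition, zero parts allowed) is a filling of shape $\gamma$ with the colored letters $x_y$, $1\le y\le\lambda_x$, each used once, rows increasing from left to right in prismatic order. The companion $\mathfrak c(F)$ of a filling $F$ of shape $\lambda$ is the colored tabloid obtained by placing, for each cell $(r,c)$ with entry $e$ in $F$, the colored letter $r_c$ in row $e$, and sorting rows increasingly. The circle of a colored tabloid: its entries are placed on a circle clockwise from a marked point $\star$, first row 1 in decreasing prismatic order, then row 2 in decreasing prismatic order, etc. A colored tabloid is faithfully colored when for each $i\ge1$, ignoring entries of color $<i$, the first $1$ clockwise from $\star$ has color $i$ and, for each $x\ge 1$, the first $x+1$ encountered clockwise from $x_i$ (if any) has color $i$. The faithful recoloring $T_0$ of $T$ is the unique faithfully colored tabloid having the same letters in each row as $T$ (colors forgotten) and the same weight. Cocharge. For a colored tabloid $T$ of partition weight $\lambda$ and each color $i$, consider on the circle of $T$ only the entries of color $i$, whose letters are $1,\dots,\lambda'_i$: label letter $1$ with $0$; label letter $a$ with the label of $a-1$ if $\star$ is passed reading clockwise from $a-1$ to $a$, and with that label plus $1$ otherwise. $\mathrm{cocharge}(T)$ is the sum of all labels over all colors $i=1,\dots,\lambda_1$. *)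

(* Defs.v *)
From mathcomp Require Import all_boot.
Set Implicit Arguments.
Unset Strict Implicit.
Unset Printing Implicit Defensive.

(* Row, column, letter and color numbers start at 1, as in the mathematics;
   only the positions used by [nth] and [index] start at 0, whence the [.-1]. *)

Definition is_partition (lam : seq nat) : bool :=
  sorted geq lam && (0 \notin lam).

Definition part (lam : seq nat) (r : nat) : nat := nth 0 lam r.-1.

Definition conj_part (lam : seq nat) (c : nat) : nat :=
  count (fun p => c <= p) lam.

(* A filling is the sequence of its rows, the bottom row (row 1) first.  An
   element b_1 (x) ... (x) b_l of B(lam_1) (x) ... (x) B(lam_l) is the sequence
   of the words b_1, ..., b_l, so that it is literally equal to the tabloid f_b
   of shape lam whose i-th row from the bottom is b_i. *)
Definition filling := seq (seq nat).

Definition in_tensor (lam : seq nat) (b : filling) : bool :=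
  [&& shape b == lam,
      all (sorted leq) b
    & all (all (fun e => 0 < e <= sumn lam)) b].

(* A word w_m ... w_1 is stored in the order of construction w_1, ..., w_m. *)

Definition smallest (s : seq nat) : nat := foldr minn (head 0 s) s.

Definition next_letter (prev : nat) (s : seq nat) : nat :=
  if has (fun e => prev < e) s
  then smallest [seq e <- s | prev < e] else smallest s.

Fixpoint next_letters (prev : nat) (rows : filling) : seq nat :=
  if rows is s :: rows' then
    let w := next_letter prev s in w :: next_letters w rows'
  else [::].

Definition first_word (rows : filling) : seq nat :=
  if rows is s :: rows' then
    let w := smallest s in w :: next_letters w rows'
  else [::].

(* [heights] lists the lengths of the words still to be read.  The [zip] drops
   the rows above the current word: no later word reaches them, because the
   lengths lam'_1, lam'_2, ... weakly decrease. *)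
Fixpoint read_words (heights : seq nat) (rows : filling) : seq (seq nat) :=
  if heights is m :: heights' then
    let w := first_word (take m rows) in
    w :: read_words heights' [seq rem p.1 p.2 | p <- zip w rows]
  else [::].

Definition zwords (lam : seq nat) (b : filling) : seq (seq nat) :=
  read_words [seq conj_part lam k | k <- iota 1 (part lam 1)] b.

Definition maj (w : seq nat) : nat :=
  \sum_(1 <= j < size w | nth 0 w j.-1 < nth 0 w j) (size w - j).

Definition zmaj (lam : seq nat) (b : filling) : nat :=
  \sum_(w <- zwords lam b) maj w.

(* [(x, y)] is the letter x with color y. *)
Definition cletter := (nat * nat)%type.

Definition prism_lt : rel cletter :=
  fun p q => (p.1 < q.1) || (p.1 == q.1) && (q.2 < p.2).

Definition prism_le : rel cletter := fun p q => (p == q) || prism_lt p q.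

(* Rows 1, 2, ... of a colored tabloid, empty rows included. *)
Definition ctabloid := seq (seq cletter).

Definition colored_letters (lam : seq nat) : seq cletter :=
  [seq (x, y) | x <- iota 1 (size lam), y <- iota 1 (part lam x)].

Definition is_colored_tabloid (lam gam : seq nat) (T : ctabloid) : bool :=
  [&& shape T == gam,
      all (sorted prism_lt) T
    & perm_eq (flatten T) (colored_letters lam)].

Definition row (F : filling) (r : nat) : seq nat := nth [::] F r.-1.

Definition cells (F : filling) : seq (nat * nat) :=
  [seq (r, c) | r <- iota 1 (size F), c <- iota 1 (size (row F r))].

Definition entry (F : filling) (z : nat * nat) : nat :=
  nth 0 (row F z.1) z.2.-1.

(* The cell (r, c) is the same pair as the colored letter r_c.  There are
   |lam| rows, since the entries of F are at most |lam|. *)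
Definition companion (F : filling) : ctabloid :=
  [seq sort prism_le [seq z <- cells F | entry F z == e]
  | e <- iota 1 (sumn (shape F))].

(* The clockwise reading of the circle, from the marked point. *)
Definition circle (T : ctabloid) : seq cletter := flatten (map rev T).

Definition first_has_color (i a : nat) (s : seq cletter) : bool :=
  if ohead [seq z <- s | z.1 == a] is Some z then z.2 == i else true.

Definition faithfully_colored (T : ctabloid) : Prop :=
  forall i, 0 < i ->
    let s := [seq z <- circle T | i <= z.2] in
    first_has_color i 1 s /\
    (forall x, 0 < x -> (x, i) \in s ->
       first_has_color i x.+1 (rot (index (x, i) s) s)).

Definition is_faithful_recoloring (lam : seq nat) (T T0 : ctabloid) : Prop :=
  [/\ is_colored_tabloid lam (shape T) T0,
      map unzip1 T0 = map unzip1 T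
    & faithfully_colored T0].

(* [s] is the clockwise reading of the entries of color [i]; the marked point
   is passed from a - 1 to a exactly when a comes before a - 1 in [s]. *)
Fixpoint cocharge_label (s : seq cletter) (i a : nat) : nat :=
  if a is a'.+1 then
    if a' is 0 then 0
    else cocharge_label s i a' + (index (a', i) s < index (a, i) s)
  else 0.

Definition cocharge (lam : seq nat) (T : ctabloid) : nat :=
  \sum_(1 <= i < (part lam 1).+1) \sum_(1 <= a < (conj_part lam i).+1)
     cocharge_label [seq z <- circle T | z.2 == i] i a.

(* Main.v *)
(* Write rho(x_y) for the row of the colored letter x_y.  A colored tabloid of
   weight lam is determined by rho, hence by the words
   w^y = rho(1_y) rho(2_y) ... of its colors.  Within a row the circle lists
   larger letters first, so the first x+1 met clockwise from x_i lies in the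
   smallest available row larger than rho(x_i), or in the smallest one if there
   is none: faithful coloring is exactly the greedy rule that selects the words
   of Z(b).  The same remark shows that the cocharge label increases from x_i to
   (x+1)_i exactly at the ascents rho(x_i) < rho((x+1)_i), so that summing the
   labels of color i counts each ascent j of w^i with multiplicity lam'_i - j. *)
Require Import Defs.
From mathcomp Require Import all_boot zify.
Set Implicit Arguments.
Unset Strict Implicit.
Unset Printing Implicit Defensive.

(** * Greedy choice of letters from rows *)

Lemma smallest_mem (s : seq nat) : s != [::] -> smallest s \in s.
Proof.
have aux (h : nat) (t : seq nat) : foldr minn h t \in h :: t.
  elim: t => [|e t IH] /=; first exact: mem_head.
  rewrite /minn; case: ifP => _; first by rewrite !inE eqxx orbT.
  by move: IH; rewrite !inE => /orP[->|->]; rewrite ?orbT.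
case: s => [//|e s] _; rewrite /smallest -[head 0 _]/e.
by move: (aux e (e :: s)); rewrite inE => /orP[/eqP->|//]; rewrite mem_head.
Qed.

Lemma smallest_le (s : seq nat) (e : nat) : e \in s -> smallest s <= e.
Proof.
rewrite /smallest; move: (head 0 s) => h.
elim: s => [//|f s IH]; rewrite inE /= geq_min => /orP[/eqP->|/IH->].
  by rewrite leqnn.
by rewrite orbT.
Qed.

Lemma smallest_perm (s t : seq nat) : perm_eq s t -> smallest s = smallest t.
Proof.
case: s => [|e s] st.
  by move: st; rewrite perm_sym => /perm_nilP->.
have t0 : t != [::] by rewrite -size_eq0 -(perm_size st).
apply/eqP; rewrite eqn_leq; apply/andP; split; apply: smallest_le.
  by rewrite (perm_mem st) smallest_mem.
by rewrite -(perm_mem st) smallest_mem.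
Qed.

Lemma next_letter_perm (p : nat) (s t : seq nat) :
  perm_eq s t -> next_letter p s = next_letter p t.
Proof.
move=> st; rewrite /next_letter (perm_has _ st) (smallest_perm st).
by rewrite (smallest_perm (perm_filter _ st)).
Qed.

Lemma next_letter_mem (p : nat) (s : seq nat) :
  s != [::] -> next_letter p s \in s.
Proof.
rewrite /next_letter; case: ifP => [|_]; last exact: smallest_mem.
by rewrite has_filter => /smallest_mem; rewrite mem_filter => /andP[].
Qed.

(** Letters are positive, so a fictitious predecessor 0 makes the first choice of a word an instance
    of the general one. *)
Lemma next_letter0 (s : seq nat) :
  all (leq 1) s -> next_letter 0 s = smallest s.
Proof.
by move=> s0; rewrite /next_letter (all_filterP s0) if_same.
Qed.

Lemma size_next_letters (p : nat) (rows : filling) :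
  size (next_letters p rows) = size rows.
Proof. by elim: rows p => //= s rows IH p; rewrite IH. Qed.

Lemma nth_next_letters (p : nat) (rows : filling) (x : nat) :
  x < size rows ->
  nth 0 (next_letters p rows) x =
  next_letter (nth 0 (p :: next_letters p rows) x) (nth [::] rows x).
Proof. by elim: rows p x => //= s rows IH p [|x] //=; apply: IH. Qed.

Lemma next_letters_perm (p : nat) (rows rows' : filling) :
  all2 perm_eq rows rows' -> next_letters p rows = next_letters p rows'.
Proof.
elim: rows rows' p => [|s rows IH] [|s' rows'] p //= /andP[ss rr].
by rewrite (next_letter_perm _ ss) (IH _ _ rr).
Qed.

Lemma first_word_perm (rows rows' : filling) :
  all2 perm_eq rows rows' -> first_word rows = first_word rows'.
Proof.
case: rows rows' => [|s rows] [|s' rows'] //= /andP[ss rr].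
by rewrite (smallest_perm ss) (next_letters_perm _ rr).
Qed.

Lemma first_wordE (rows : filling) :
  all (all (leq 1)) rows -> first_word rows = next_letters 0 rows.
Proof. by case: rows => //= s rows /andP[s0 _]; rewrite next_letter0. Qed.

Lemma size_first_word (rows : filling) :
  size (first_word rows) = size rows.
Proof. by case: rows => //= s rows; rewrite size_next_letters. Qed.

Lemma first_word_mem (rows : filling) (x : nat) :
  x < size rows -> nth [::] rows x != [::] ->
  nth 0 (first_word rows) x \in nth [::] rows x.
Proof.
case: rows x => // s rows [|x] /= xl s0; first exact: smallest_mem.
by rewrite nth_next_letters //; apply: next_letter_mem.
Qed.

(** * Families of words that obey the greedy rule *)

Definition column (V : seq (seq nat)) (x : nat) : seq nat :=
  [seq nth 0 w x | w <- V & x < size w].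

(** The greedy rule in terms of the words alone: when word [k] is chosen, what is left of each row
    is what the words from [k] on take from it, hence [drop k V]. In this form the rule also makes
    sense for the color words of a tabloid. *)
Definition faithful_words (V : seq (seq nat)) : Prop :=
  forall k, k < size V ->
    nth [::] V k =
    first_word (mkseq (column (drop k V)) (size (nth [::] V k))).

Lemma column_cons (w : seq nat) (V : seq (seq nat)) (x : nat) :
  column (w :: V) x =
  if x < size w then nth 0 w x :: column V x else column V x.
Proof. by rewrite /column /=; case: ifP. Qed.

Lemma first_word_columns (V : seq (seq nat)) (rows : filling) (m : nat) :
  m <= size rows ->
  (forall x, x < m -> perm_eq (column V x) (nth [::] rows x)) ->
  first_word (mkseq (column V) m) = first_word (take m rows).
Proof.
move=> mr Vr; apply: first_word_perm; rewrite all2E size_mkseq size_takel //.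
rewrite eqxx /=; apply/(all_nthP ([::], [::])) => x.
rewrite size_zip size_mkseq size_takel // minnn => xm.
by rewrite nth_zip ?size_mkseq ?size_takel // nth_mkseq // nth_take //= Vr.
Qed.

Lemma size_residual_rows (m : nat) (rows : filling) :
  m <= size rows ->
  size [seq rem p.1 p.2 | p <- zip (first_word (take m rows)) rows] = m.
Proof.
move=> mr; rewrite size_map size_zip size_first_word size_takel //.
exact/minn_idPl.
Qed.

Lemma nth_residual_rows (m : nat) (rows : filling) (x : nat) :
  x < m -> m <= size rows ->
  nth [::] [seq rem p.1 p.2 | p <- zip (first_word (take m rows)) rows] x =
  rem (nth 0 (first_word (take m rows)) x) (nth [::] rows x).
Proof.
move=> xm mr; have := size_residual_rows mr; rewrite size_map => sz.
by rewrite (nth_map (0, [::])) ?nth_zip_cond sz xm.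
Qed.

(** The columns give each row as a multiset, so the rule forces the first word; deleting its letters
    leaves the columns of the other words, and induction applies. As lengths decrease, the rows
    dropped above a word are not reached later. *)
Lemma read_words_unique (V : seq (seq nat)) (rows : filling) :
  path geq (size rows) (map size V) ->
  (forall x, x < size rows -> perm_eq (column V x) (nth [::] rows x)) ->
  faithful_words V -> V = read_words (map size V) rows.
Proof.
elim: V rows => [//|w V IH] rows /= /andP[wr pV] cV fV.
have ew : w = first_word (take (size w) rows).
  rewrite [LHS](fV 0 isT) /= (first_word_columns wr) // => x xw.
  by apply: cV; apply: leq_trans xw wr.
congr (_ :: _) => //; apply: IH.
- by rewrite size_residual_rows.
- move=> x; rewrite size_residual_rows // => xw.
  rewrite nth_residual_rows // -ew.
  have := cV x (leq_trans xw wr); rewrite column_cons xw => cx.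
  rewrite -(perm_cons (nth 0 w x)) (perm_trans cx) // perm_to_rem //.
  by rewrite -(perm_mem cx) mem_head.
- by move=> k kV; apply: (fV k.+1 kV).
Qed.

(** Existence, to match the uniqueness above: a row with as many letters as there are words reaching
    it always has a letter to offer and ends up empty. *)
Lemma read_words_correct (hs : seq nat) (rows : filling) :
  path geq (size rows) hs ->
  (forall x, x < size rows ->
     size (nth [::] rows x) = count (fun h => x < h) hs) ->
  let V := read_words hs rows in
  [/\ map size V = hs, faithful_words V
    & forall x, x < size rows -> perm_eq (column V x) (nth [::] rows x)].
Proof.
elim: hs rows => [|m hs IH] rows /=.
  by move=> _ sr; split=> // x /sr /size0nil ->.
move=> /andP[mr ph] sr; set w := first_word _; set rows' := [seq rem p.1 p.2 | p <- _].
have sw : size w = m by rewrite size_first_word size_takel.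
have sr' : size rows' = m by exact: size_residual_rows.
have nr x : x < m -> nth [::] rows' x = rem (nth 0 w x) (nth [::] rows x).
  by move=> xm; exact: nth_residual_rows.
have wx x : x < m -> nth 0 w x \in nth [::] rows x.
  move=> xm; rewrite -(nth_take [::] xm); apply: first_word_mem.
    by rewrite size_takel.
  by rewrite nth_take // -size_eq0 sr ?xm //; apply: leq_trans xm mr.
case: (IH rows') => [|x|eV fV cV].
- by rewrite sr'.
- rewrite sr' => xm; rewrite nr // size_rem ?wx //.
  by rewrite sr ?xm //; apply: leq_trans xm mr.
have cVw x : x < size rows ->
    perm_eq (column (w :: read_words hs rows') x) (nth [::] rows x).
  move=> xr; rewrite column_cons sw; case: ltnP => [xm|mx].
    rewrite perm_sym (perm_trans (perm_to_rem (wx _ xm))) // perm_cons.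
    by rewrite perm_sym -nr // cV // sr'.
  (* Later heights are at most [m], hence at most [x]: the row is empty by its prescribed size, and
     no later word has a letter in this column. *)
  have hx : all (fun h => h <= x) hs.
    have gt : transitive geq by move=> a b c /= ba ac; apply: leq_trans ac ba.
    move: (order_path_min gt ph); apply: sub_all => h /= hm.
    exact: leq_trans hm mx.
  have h0 : has (fun h => x < h) hs = false.
    by apply/negbTE; rewrite -all_predC; apply: sub_all hx => h /=; rewrite -leqNgt.
  rewrite (size0nil (s := nth [::] rows x)); last first.
    by rewrite sr // ltnNge mx /=; apply/eqP; rewrite -leqn0 leqNgt -has_count h0.
  suff -> : column (read_words hs rows') x = [::] by [].
  rewrite /column (_ : filter _ _ = [::]) //; apply/eqP.
  rewrite -[_ == _]negbK -has_filter -(has_map size (fun h => x < h)) eV.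
  by rewrite h0.
split=> //; first by rewrite sw eV.
case=> [_|k kV] /=; last exact: fV.
rewrite sw (first_word_columns mr) // => x xm.
by apply: cVw; apply: leq_trans xm mr.
Qed.

(** * Colored letters and conjugate parts *)

Lemma mem_colored_letters (lam : seq nat) (z : cletter) :
  (z \in colored_letters lam) = (0 < z.1) && (0 < z.2 <= part lam z.1).
Proof.
case: z => x y; apply/allpairsPdep/idP => [[x' [y' [hx hy [-> ->]]]] /=|/= h].
  by move: hx hy; rewrite !mem_iota; lia.
exists x, y; split=> //; rewrite mem_iota; last by lia.
have xl : x.-1 < size lam; last by lia.
by rewrite ltnNge; apply/negP => /(nth_default 0); move: h; rewrite /part; lia.
Qed.

Lemma uniq_colored_letters (lam : seq nat) : uniq (colored_letters lam).
Proof.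
apply: allpairs_uniq_dep; rewrite ?iota_uniq //.
  by move=> x _; exact: iota_uniq.
by move=> [x y] [x' y'] _ _ /= [-> ->].
Qed.

(** These are the letters [x] that survive when colors below [i] are ignored; truncated subtraction
    gives the empty list when [i] exceeds the part. *)
Lemma filter_letter_colors (lam : seq nat) (x i : nat) : 0 < x -> 0 < i ->
  perm_eq [seq z <- colored_letters lam | (z.1 == x) && (i <= z.2)]
          [seq (x, y) | y <- iota i ((part lam x).+1 - i)].
Proof.
move=> x0 i0; apply: uniq_perm.
- by rewrite filter_uniq // uniq_colored_letters.
- by rewrite map_inj_uniq ?iota_uniq // => y y' [].
case=> x' y; rewrite mem_filter mem_colored_letters /=.
apply/idP/mapP => [h|[y']].
  by exists y; [rewrite mem_iota; move: h; case: eqP => // ->; lia|]; 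
     move: h; case: eqP => // ->.
by rewrite mem_iota => h [-> ->]; rewrite eqxx; lia.
Qed.

(** The parts weakly decrease, so those that are at least [y] form an initial segment. Since [y] is
    positive, the default part 0 beyond the end agrees with this. *)
Lemma leq_conj_part (lam : seq nat) (x y : nat) :
  is_partition lam -> 0 < x -> 0 < y ->
  (x <= conj_part lam y) = (y <= part lam x).
Proof.
case/andP=> sl _; case: x => // x _ y0; rewrite /conj_part /part /=.
elim: lam x sl => [|p lam IH] x /=; first by rewrite nth_nil; lia.
move=> pl; have gt : transitive geq by move=> a b c /= ba ac; apply: leq_trans ac ba.
have := order_path_min gt pl; have := path_sorted pl => sl al.
case: (leqP y p) => yp.
  by case: x => [|x] /=; rewrite ?add1n ?ltnS ?IH //.
have -> : count (fun q => y <= q) lam = 0.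
  apply/eqP; rewrite -leqn0 leqNgt -has_count -all_predC.
  by apply: sub_all al => q /=; lia.
case: x => [|x] /=; first by lia.
by case: (ltnP x (size lam)) => xl; 
  [have := all_nthP 0 al x xl; move=> /=; lia | rewrite nth_default //; lia].
Qed.

(** * Colored tabloids given by row functions, and their circles *)

Definition tabloid_of (lam : seq nat) (rho : cletter -> nat) : ctabloid :=
  [seq sort prism_le [seq z <- colored_letters lam | rho z == e]
  | e <- iota 1 (sumn lam)].

(** Ensures that no colored letter is lost, as [tabloid_of] only has the rows 1, ..., [sumn lam]. *)
Definition row_bounded (lam : seq nat) (rho : cletter -> nat) : Prop :=
  {in colored_letters lam, forall z, 0 < rho z <= sumn lam}.

Lemma prism_lt_trans : transitive prism_lt.
Proof. by move=> [a b] [c d] [e f]; rewrite /prism_lt /=; lia. Qed.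

Lemma prism_lt_irr : irreflexive prism_lt.
Proof. by move=> [a b]; rewrite /prism_lt /=; lia. Qed.

Lemma prism_le_total : total prism_le.
Proof. by move=> [a b] [c d]; rewrite /prism_le /prism_lt -!pair_eqE /=; lia. Qed.

Lemma prism_le_trans : transitive prism_le.
Proof.
by move=> [a b] [c d] [e f]; rewrite /prism_le /prism_lt -!pair_eqE /=; lia.
Qed.

Lemma sort_prism_sorted (s : seq cletter) :
  uniq s -> sorted prism_lt (sort prism_le s).
Proof.
move=> us; rewrite (sorted_pairwise prism_lt_trans).
have := sort_sorted prism_le_total s.
rewrite (sorted_pairwise prism_le_trans) => pw.
have : uniq (sort prism_le s) by rewrite sort_uniq.
rewrite uniq_pairwise => pu.
have : pairwise [rel x y | prism_le x y && (x != y)] (sort prism_le s).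
  by rewrite pairwise_relI pw pu.
apply: sub_pairwise => x y /andP[/orP[/eqP->|//]].
by rewrite eqxx.
Qed.

(** The order of the clockwise reading from the marked point: by row, then larger letters first,
    then smaller colors first. *)
Definition circ_lt (rho : cletter -> nat) : rel cletter :=
  fun z z' => (rho z < rho z') || (rho z == rho z') && prism_lt z' z.

Lemma circ_lt_trans (rho : cletter -> nat) : transitive (circ_lt rho).
Proof. by move=> [a b] [c d] [e f]; rewrite /circ_lt /prism_lt /=; lia. Qed.

Lemma circ_lt_irr (rho : cletter -> nat) : irreflexive (circ_lt rho).
Proof. by move=> [a b]; rewrite /circ_lt /prism_lt /=; lia. Qed.

Lemma circle_tabloid_of_sorted (lam : seq nat) (rho : cletter -> nat) :
  sorted (circ_lt rho) (circle (tabloid_of lam rho)).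
Proof.
rewrite (sorted_pairwise (@circ_lt_trans rho)) /circle /tabloid_of -map_comp.
(* Induction on the number of rows, the first of them having an arbitrary number [m]. *)
elim: (sumn lam) 1 => [//|n IH] m /=; rewrite pairwise_cat IH andbT.
apply/andP; split.
  apply/allrelP => z z'; rewrite mem_rev mem_sort mem_filter => /andP[/eqP zm _].
  case/flattenP=> r /mapP[e]; rewrite mem_iota => em ->.
  rewrite /= mem_rev mem_sort mem_filter => /andP[/eqP z'e _].
  by rewrite /circ_lt zm z'e; lia.
(* Inside row [m], reversal turns [prism_lt] into the second clause of [circ_lt]. *)
have := sort_prism_sorted (filter_uniq (fun z => rho z == m)
                             (uniq_colored_letters lam)).
rewrite -[sort _ _]revK rev_sorted revK; set s := rev _ => pw.
have sm : all (fun z => rho z == m) s.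
  by apply/allP => z; rewrite mem_rev mem_sort mem_filter => /andP[].
rewrite -(sorted_pairwise (@circ_lt_trans rho)); move: sm pw.
apply: sub_in_sorted => z z' /eqP zm /eqP z'm /= h.
by rewrite /circ_lt zm z'm eqxx h orbT.
Qed.

Lemma mem_tabloid_of (lam : seq nat) (rho : cletter -> nat) :
  row_bounded lam rho -> flatten (tabloid_of lam rho) =i colored_letters lam.
Proof.
move=> rb z; apply/flatten_mapP/idP => [[e _]|zc].
  by rewrite mem_sort mem_filter => /andP[].
by exists (rho z); rewrite ?mem_iota ?mem_sort ?mem_filter ?eqxx //; move: (rb z zc); lia.
Qed.

Lemma mem_circle (T : ctabloid) : circle T =i flatten T.
Proof.
by move=> z; rewrite /circle; elim: T => //= r T IH; rewrite !mem_cat mem_rev IH.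
Qed.

Lemma uniq_circle_tabloid_of (lam : seq nat) (rho : cletter -> nat) :
  uniq (circle (tabloid_of lam rho)).
Proof.
exact: sorted_uniq (@circ_lt_trans rho) (@circ_lt_irr rho) _
  (circle_tabloid_of_sorted lam rho).
Qed.

Lemma perm_circle (T : ctabloid) : perm_eq (circle T) (flatten T).
Proof.
rewrite /circle; elim: T => //= r T IH; apply: perm_cat => //.
by rewrite perm_rev.
Qed.

Lemma perm_circle_tabloid_of (lam : seq nat) (rho : cletter -> nat) :
  row_bounded lam rho ->
  perm_eq (circle (tabloid_of lam rho)) (colored_letters lam).
Proof.
move=> rb; apply: uniq_perm; rewrite ?uniq_circle_tabloid_of ?uniq_colored_letters //.
by move=> z; rewrite mem_circle mem_tabloid_of.
Qed.

Lemma tabloid_of_colored (lam : seq nat) (rho : cletter -> nat) :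
  row_bounded lam rho ->
  is_colored_tabloid lam (shape (tabloid_of lam rho)) (tabloid_of lam rho).
Proof.
move=> rb; rewrite /is_colored_tabloid eqxx /=; apply/andP; split.
  by apply/allP => r /mapP[e _ ->]; rewrite sort_prism_sorted // filter_uniq // uniq_colored_letters.
by rewrite -(permPl (perm_circle _)) perm_circle_tabloid_of.
Qed.

Lemma eq_tabloid_of (lam : seq nat) (rho rho' : cletter -> nat) :
  {in colored_letters lam, rho =1 rho'} ->
  tabloid_of lam rho = tabloid_of lam rho'.
Proof.
move=> rr; apply: eq_map => e; congr sort; apply: eq_in_filter => z zc.
by rewrite rr.
Qed.

(** * Recovering the row function from a colored tabloid *)

Definition row_index (T : ctabloid) (z : cletter) : nat :=
  (find (fun r => z \in r) T).+1.

Lemma row_index_nth (T : ctabloid) (k : nat) (z : cletter) :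
  uniq (flatten T) -> z \in nth [::] T k -> row_index T z = k.+1.
Proof.
rewrite /row_index; elim: T k => [|r T IH] k /=; first by rewrite nth_nil.
rewrite cat_uniq => /and3P[_ /hasPn rT uT]; case: k => [|k] /=; first by move=> ->.
move=> zT; rewrite (IH _ uT zT) ifN //; apply: rT; apply/flattenP.
exists (nth [::] T k) => //; apply: mem_nth.
by rewrite ltnNge; apply/negP => /(nth_default [::]) eT; rewrite eT in zT.
Qed.

(** Strictly sorted rows with the same members coincide, so [T] is rebuilt from the row numbers of
    its letters. *)
Lemma colored_tabloidE (lam gam : seq nat) (T : ctabloid) :
  is_colored_tabloid lam gam T -> size T = sumn lam ->
  row_bounded lam (row_index T) /\ T = tabloid_of lam (row_index T).
Proof.
case/and3P=> _ sT pT nT.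
have uT : uniq (flatten T) by rewrite (perm_uniq pT) uniq_colored_letters.
split.
  move=> z; rewrite -(perm_mem pT) => /flattenP[r rT zr].
  by rewrite /row_index /= -nT -has_find; apply/hasP; exists r.
apply: (@eq_from_nth _ [::]); rewrite ?size_map ?size_iota // => k kT.
rewrite (nth_map 0) ?size_iota -?nT // nth_iota -?nT // add1n.
apply: (irr_sorted_eq prism_lt_trans prism_lt_irr).
- by apply: (allP sT); apply: mem_nth.
- by rewrite sort_prism_sorted // filter_uniq // uniq_colored_letters.
move=> z; rewrite mem_sort mem_filter -(perm_mem pT).
apply/idP/andP => [zk|[/eqP [fz] /flattenP[r rT zr]]].
  split; first by rewrite (row_index_nth uT zk).
  by apply/flattenP; exists (nth [::] T k) => //; apply: mem_nth.
by rewrite -fz; apply: (nth_find _ (a := fun r => z \in r)); apply/hasP; exists r.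
Qed.

(** The multiplicity of the letter [x] in row [e] is the multiplicity of [e] among the rows of the
    letters [x]; both conditions say that these numbers agree for [rho] and [rho']. *)
Lemma unzip1_tabloid_ofP (lam : seq nat) (rho rho' : cletter -> nat) :
  row_bounded lam rho -> row_bounded lam rho' ->
  map unzip1 (tabloid_of lam rho) = map unzip1 (tabloid_of lam rho') <->
  (forall x, 0 < x -> perm_eq [seq rho (x, y) | y <- iota 1 (part lam x)]
                              [seq rho' (x, y) | y <- iota 1 (part lam x)]).
Proof.
move=> rb rb'.
have cnt (r : cletter -> nat) e x : 0 < x ->
    count_mem x (unzip1 (sort prism_le [seq z <- colored_letters lam | r z == e]))
    = count_mem e [seq r (x, y) | y <- iota 1 (part lam x)].
  move=> x0; rewrite count_map; move/permP: (permEl (perm_sort prism_le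
     [seq z <- colored_letters lam | r z == e])) => ->.
  rewrite count_filter; have /permP := filter_letter_colors lam x0 (isT : 0 < 1).
  move=> /(_ (fun z => r z == e)); rewrite count_map subn1 /= => H.
  rewrite count_map; transitivity (count (fun y => r (x, y) == e) (iota 1 (part lam x))) => //.
  rewrite -[RHS]H count_filter; apply: eq_in_count => z.
  by rewrite mem_colored_letters /= => /andP[_ /andP[-> _]]; rewrite andbT andbC.
have in_row x e (r : cletter -> nat) : 0 < x -> row_bounded lam r ->
    e \in [seq r (x, y) | y <- iota 1 (part lam x)] -> 0 < e <= sumn lam.
  move=> x0 rr /mapP[y]; rewrite mem_iota => yx ->.
  by apply: rr; rewrite mem_colored_letters /=; lia.
split=> [eu x x0|pr].
  apply/allP => e; rewrite mem_cat => ein; apply/eqP.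
  (* A value that occurs is a genuine row number, so position [e.-1] is row [e] and not the
     default. *)
  have en : 0 < e <= sumn lam by case/orP: ein; apply: in_row.
  have /= := congr1 (fun T => nth [::] T e.-1) eu.
  rewrite /tabloid_of -!map_comp !(nth_map 0) ?size_iota ?nth_iota; try lia.
  rewrite /= add1n prednK; last by lia.
  by rewrite -!cnt // => ->.
rewrite /tabloid_of -!map_comp; apply: eq_map => e /=.
(* Without its colors a row is a weakly increasing word, hence determined by its multiplicities. *)
apply: (sorted_eq leq_trans anti_leq).
- rewrite sorted_map; apply: (sub_sorted _ (sort_prism_sorted _)).
    by move=> z z'; rewrite /prism_lt /relpre /=; lia.
  by rewrite filter_uniq // uniq_colored_letters.
- rewrite sorted_map; apply: (sub_sorted _ (sort_prism_sorted _)).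
    by move=> z z'; rewrite /prism_lt /relpre /=; lia.
  by rewrite filter_uniq // uniq_colored_letters.
apply/allP => x; rewrite mem_cat => xin; apply/eqP.
have x0 : 0 < x.
  by case/orP: xin => /mapP[z]; rewrite mem_sort mem_filter mem_colored_letters
     => /and3P[_ z0 _] ->.
by rewrite !cnt //; apply/permP/pr.
Qed.

(** * Color words and the greedy rule *)

Definition word_of (lam : seq nat) (rho : cletter -> nat) (y : nat) : seq nat :=
  [seq rho (x, y) | x <- iota 1 (conj_part lam y)].

Definition words_of (lam : seq nat) (rho : cletter -> nat) : seq (seq nat) :=
  [seq word_of lam rho y | y <- iota 1 (part lam 1)].

(** The rows still open to the letter [x] of color [i] once the smaller colors are placed. *)
Definition available (lam : seq nat) (rho : cletter -> nat) (x i : nat) :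
  seq nat := [seq rho (x, y) | y <- iota i ((part lam x).+1 - i)].

(** The value 0, below every row, stands for the marked point. *)
Definition previous (rho : cletter -> nat) (x i : nat) : nat :=
  if x is 0 then 0 else rho (x, i).

(** The middle term: [faithful_words] for the color words and [faithfully_colored] for the tabloid
    are both shown equivalent to it. *)
Definition greedy (lam : seq nat) (rho : cletter -> nat) : Prop :=
  forall x i, (x.+1, i) \in colored_letters lam ->
  rho (x.+1, i) = next_letter (previous rho x i) (available lam rho x.+1 i).

Lemma nth_word_of (lam : seq nat) (rho : cletter -> nat) (x y : nat) :
  x < conj_part lam y -> nth 0 (word_of lam rho y) x = rho (x.+1, y).
Proof. by move=> xy; rewrite (nth_map 0) ?size_iota // nth_iota. Qed.

Lemma part_le1 (lam : seq nat) (x y : nat) : is_partition lam -> 0 < x ->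
  0 < y -> y <= part lam x -> y <= part lam 1.
Proof.
by move=> hl x0 y0; rewrite -!leq_conj_part //; apply: leq_trans.
Qed.

Lemma partS_le (lam : seq nat) (x : nat) : is_partition lam -> 0 < x ->
  part lam x.+1 <= part lam x.
Proof.
move=> hl x0; case E: (part lam x.+1) => [//|p]; rewrite -leq_conj_part //.
by apply: ltnW; rewrite leq_conj_part // E.
Qed.

(** Dropping [i.-1] words leaves the colors from [i] on, and by conjugation the word of color [y]
    reaches position [x] exactly when [y <= part lam x.+1]. *)
Lemma column_words_of (lam : seq nat) (rho : cletter -> nat) (x i : nat) :
  is_partition lam -> 0 < i ->
  column (drop i.-1 (words_of lam rho)) x = available lam rho x.+1 i.
Proof.
move=> hl i0; rewrite /column /words_of -map_drop drop_iota filter_map -map_comp.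
rewrite add1n prednK // /available.
have -> : [seq y <- iota i (part lam 1 - i.-1) | x < size (word_of lam rho y)]
          = iota i ((part lam x.+1).+1 - i).
  apply: (irr_sorted_eq ltn_trans ltnn).
  - by apply: sorted_filter; [exact: ltn_trans | exact: iota_ltn_sorted].
  - exact: iota_ltn_sorted.
  move=> y; rewrite mem_filter !mem_iota size_map size_iota.
  case: (posnP y) => [->|y0]; first by lia.
  rewrite leq_conj_part //; have := part_le1 hl (isT : 0 < x.+1) y0.
  by case: (leqP y (part lam x.+1)) => [yx /(_ isT)|xy _] /=; lia.
apply/eq_in_map => y; rewrite mem_iota => yi /=; apply: nth_word_of.
by rewrite leq_conj_part //; lia.
Qed.

Lemma map_size_words_of (lam : seq nat) (rho : cletter -> nat) :
  map size (words_of lam rho) = [seq conj_part lam k | k <- iota 1 (part lam 1)].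
Proof.
by rewrite -map_comp; apply: eq_map => y; rewrite /= size_map size_iota.
Qed.

Lemma faithful_words_ofP (lam : seq nat) (rho : cletter -> nat) :
  is_partition lam -> row_bounded lam rho ->
  faithful_words (words_of lam rho) <-> greedy lam rho.
Proof.
move=> hl rb.
have nthw i : 0 < i <= part lam 1 ->
    nth [::] (words_of lam rho) i.-1 = word_of lam rho i.
  move=> hi; rewrite (nth_map 0) ?size_iota; last by lia.
  by rewrite nth_iota ?add1n ?prednK //; lia.
have fwE i : 0 < i ->
    let c := mkseq (column (drop i.-1 (words_of lam rho))) (conj_part lam i) in
    first_word c = next_letters 0 c.
  move=> i0 /=; apply: first_wordE; apply/allP => s /mapP[x _ ->].
  rewrite column_words_of //; apply/allP => e /mapP[y]; rewrite mem_iota => yi ->.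
  have := rb (x.+1, y); rewrite mem_colored_letters /=; lia.
have sw i : size (word_of lam rho i) = conj_part lam i.
  by rewrite size_map size_iota.
split=> [fw x i|gr k].
  rewrite mem_colored_letters => /= /andP[i0 ix].
  have i1 : 0 < i <= part lam 1 by rewrite i0 (part_le1 hl _ i0 ix).
  have xi : x < conj_part lam i by rewrite leq_conj_part.
  have := fw i.-1; rewrite size_map size_iota nthw // sw fwE // => /(_ ltac:(lia)).
  set c := mkseq _ _ => e.
  have sc : x < size c by rewrite size_mkseq.
  rewrite -(nth_word_of rho xi) {1}e nth_next_letters // -e nth_mkseq // column_words_of //.
  congr next_letter; case: x xi {ix sc} => [//|x] xi.
  by rewrite /= nth_word_of // ltnW.
rewrite size_map size_iota => kl; have k1 : 0 < k.+1 <= part lam 1 by lia.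
rewrite -[k]/(k.+1.-1) nthw // sw fwE //; set c := mkseq _ _.
have sc : size c = conj_part lam k.+1 by rewrite size_mkseq.
apply: (@eq_from_nth _ 0); rewrite sw ?size_next_letters ?sc // => x.
(* Induction along the word, because each choice depends on the letter chosen just before. *)
elim: x => [|x IH] xk; rewrite nth_next_letters ?sc // nth_mkseq // column_words_of //.
  rewrite nth_word_of // gr //= mem_colored_letters /=.
  by rewrite -leq_conj_part.
rewrite nth_word_of // gr; last by rewrite mem_colored_letters /= -leq_conj_part.
by congr next_letter; rewrite /= -IH 1?ltnW // nth_word_of // ltnW.
Qed.

(** * Faithful coloring read on the circle *)

Lemma smallest_sorted_circ (rho : cletter -> nat) (z : cletter)
    (s : seq cletter) :
  sorted (circ_lt rho) (z :: s) -> smallest (map rho (z :: s)) = rho z.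
Proof.
move=> /(order_path_min (@circ_lt_trans rho)) /allP zs.
apply/eqP; rewrite eqn_leq smallest_le ?mem_head //=.
have /mapP[z' + ->] := @smallest_mem (map rho (z :: s)) isT.
by rewrite inE => /orP[/eqP->//|/zs]; rewrite /circ_lt; lia.
Qed.

(* Among equal rows, smaller colors come first on the circle, so the first
   letter [x] is in the row of [x_i] only if it is [x_i]. *)
Lemma head_color (rho : cletter -> nat) (x i : nat) (z : cletter)
    (s : seq cletter) :
  sorted (circ_lt rho) (z :: s) -> z.1 = x -> i <= z.2 ->
  (x, i) \in z :: s -> (z.2 == i) = (rho (x, i) == rho z).
Proof.
move=> /(order_path_min (@circ_lt_trans rho)) /allP zs <- iz.
rewrite inE => /orP[/eqP <-|/zs] /=; first by rewrite !eqxx.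
rewrite /circ_lt /prism_lt /= => h.
by case: eqP => [zi|]; last lia; rewrite -zi -surjective_pairing eqxx.
Qed.

(** The circle is cut into [A], from the marked point up to the start of the search, and [B], from
    there on; [p] is the row of the start. The first [x] met is the first one of [B], or of [A] if
    [B] has none: these are the two branches of [next_letter]. By [head_color], comparing rows then
    amounts to comparing colors. *)
Lemma first_has_color_cat (rho : cletter -> nat) (x i p : nat)
    (A B : seq cletter) :
  sorted (circ_lt rho) (A ++ B) -> all (fun z => i <= z.2) (A ++ B) ->
  (forall z, z \in A -> z.1 = x -> rho z <= p) ->
  (forall z, z \in B -> z.1 = x -> p < rho z) ->
  (x, i) \in A ++ B ->
  first_has_color i x (B ++ A) =
  (rho (x, i) == next_letter p [seq rho z | z <- A ++ B & z.1 == x]).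
Proof.
move=> so /allP ai hA hB xi; rewrite /first_has_color !filter_cat map_cat.
have soF (t : seq cletter) : subseq t (A ++ B) ->
    sorted (circ_lt rho) [seq z <- t | z.1 == x].
  move=> tAB; apply: subseq_sorted so; first exact: circ_lt_trans.
  exact: subseq_trans (filter_subseq _ _) tAB.
have hpA : has (fun e => p < e) [seq rho z | z <- A & z.1 == x] = false.
  apply/hasP => -[e /mapP[z]]; rewrite mem_filter => /andP[/eqP zx zA] ->.
  by rewrite ltnNge hA.
have fB : all (fun e => p < e) [seq rho z | z <- B & z.1 == x].
  by apply/allP => e /mapP[z]; rewrite mem_filter => /andP[/eqP zx zB] ->; apply: hB.
rewrite /next_letter has_cat hpA filter_cat (all_filterP fB) /=.
have -> : [seq e <- [seq rho z | z <- A & z.1 == x] | p < e] = [::].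
  by apply/eqP; rewrite -[_ == _]negbK -has_filter hpA.
case EB: [seq z <- B | z.1 == x] => [|z b] /=.
  (* No [x] in [B]: the search passes the marked point and ends in [A]. *)
  rewrite cats0; case EA: [seq z <- A | z.1 == x] => [|z a] /=.
    have : (x, i) \in [seq z <- A ++ B | z.1 == x] by rewrite mem_filter /= eqxx.
    by rewrite filter_cat EA EB.
  have sa := soF A (prefix_subseq _ _); rewrite EA in sa.
  have [/eqP zx zA] : z.1 == x /\ z \in A.
    by apply/andP; rewrite -(mem_filter (fun z : cletter => z.1 == x)) EA mem_head.
  rewrite -[RHS]/(_ == smallest (map rho (z :: a))) smallest_sorted_circ //.
  apply: head_color sa _ _ _ => //; first by apply: ai; rewrite mem_cat zA.
  rewrite -EA; have : (x, i) \in [seq z <- A ++ B | z.1 == x].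
    by rewrite mem_filter /= eqxx.
  by rewrite filter_cat EB cats0.
have sb := soF B (suffix_subseq _ _); rewrite EB in sb.
have [/eqP zx zB] : z.1 == x /\ z \in B.
  by apply/andP; rewrite -(mem_filter (fun z : cletter => z.1 == x)) EB mem_head.
have pz := hB z zB zx; rewrite /= pz /=.
rewrite -[RHS]/(_ == smallest (map rho (z :: b))) smallest_sorted_circ //.
move: xi; rewrite mem_cat => /orP[xA|xB].
  (* Here [rho (x, i) <= p < rho z], so both sides are false. *)
  have := hA _ xA erefl => hp; have -> : rho (x, i) == rho z = false by lia.
  by apply/eqP => zi; move: hp pz; rewrite -zi -zx -surjective_pairing; lia.
apply: head_color sb _ _ _ => //; first by apply: ai; rewrite mem_cat zB orbT.
by rewrite -EB mem_filter /= eqxx.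
Qed.

Lemma faithfully_coloredP (lam : seq nat) (rho : cletter -> nat) :
  is_partition lam -> row_bounded lam rho ->
  faithfully_colored (tabloid_of lam rho) <-> greedy lam rho.
Proof.
move=> hl rb; rewrite /faithfully_colored.
set C := circle _.
have Cs i : sorted (circ_lt rho) [seq z <- C | i <= z.2].
  by apply: sorted_filter; [exact: circ_lt_trans|exact: circle_tabloid_of_sorted].
have inC i z : (z \in [seq z <- C | i <= z.2]) = (i <= z.2) && (z \in colored_letters lam).
  by rewrite mem_filter (perm_mem (perm_circle_tabloid_of rb)).
have av x i : 0 < i ->
    perm_eq [seq rho z | z <- [seq z <- C | i <= z.2] & z.1 == x.+1]
            (available lam rho x.+1 i).
  move=> i0; rewrite -filter_predI /available.
  rewrite (map_comp rho (fun y => (x.+1, y))); apply: perm_map.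
  apply: perm_trans (filter_letter_colors lam (isT : 0 < x.+1) i0).
  exact/perm_filter/perm_circle_tabloid_of.
have all_i i : all (fun z => i <= z.2) [seq z <- C | i <= z.2] by exact: filter_all.
have first1 i : 0 < i -> (1, i) \in colored_letters lam ->
    first_has_color i 1 [seq z <- C | i <= z.2] =
    (rho (1, i) == next_letter 0 (available lam rho 1 i)).
  move=> i0 hi; rewrite -(next_letter_perm _ (av 0 i i0)).
  (* The search for the first 1 starts at the marked point: [A] is empty and [p = 0] is below all
     rows. *)
  rewrite -{1}[filter _ C]cats0; apply: (@first_has_color_cat rho 1 i 0 [::]) => //=.
    by move=> z; rewrite inC => /andP[_ /rb]; lia.
  by rewrite inC hi leqnn.
have firstS x i : 0 < i -> 0 < x -> (x, i) \in colored_letters lam ->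
    (x.+1, i) \in colored_letters lam ->
    first_has_color i x.+1 (rot (index (x, i) [seq z <- C | i <= z.2])
                                [seq z <- C | i <= z.2]) =
    (rho (x.+1, i) == next_letter (rho (x, i)) (available lam rho x.+1 i)).
  move=> i0 x0 hx hx1; rewrite -(next_letter_perm _ (av x i i0)).
  have xs : (x, i) \in [seq z <- C | i <= z.2] by rewrite inC leqnn.
  have x1s : (x.+1, i) \in [seq z <- C | i <= z.2] by rewrite inC leqnn.
  set s := filter _ C in xs x1s *.
  have := Cs i; rewrite -/s -{1}(cat_take_drop (index (x, i) s) s).
  rewrite (sorted_pairwise (@circ_lt_trans rho)) pairwise_cat.
  rewrite (drop_index xs) /= => /and4P[/allrelP AB _ xB _].
  rewrite /rot.
  have := @first_has_color_cat rho x.+1 i (rho (x, i))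
            (take (index (x, i) s) s) (drop (index (x, i) s) s).
  rewrite cat_take_drop; apply=> //.
  - exact: Cs.
  - move=> z /AB zA _; have := zA _ (mem_head _ _); rewrite /circ_lt; lia.
  (* In a common row [x.+1] precedes [x] on the circle, so a letter [x.+1] met after [(x, i)] lies
     in a strictly larger row. *)
  - move=> z; rewrite (drop_index xs) inE => /orP[/eqP-> /= |]; first by lia.
    by move=> /(allP xB); rewrite /circ_lt /prism_lt /= => + zx; lia.
(* If [x.+1] does not occur with color [i], it occurs with no larger color either, and the condition
   is vacuous. *)
have none x i : 0 < i -> (x.+1, i) \notin colored_letters lam ->
    forall k, first_has_color i x.+1 (rot k [seq z <- C | i <= z.2]).
  move=> i0 nx k; rewrite /first_has_color.
  rewrite (_ : filter _ (rot _ _) = [::]) //.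
  apply/eqP; rewrite -[_ == _]negbK -has_filter; apply/hasP => -[z].
  rewrite mem_rot inC mem_colored_letters => h /eqP zx.
  by move: nx; rewrite mem_colored_letters; move: h; rewrite zx /=; lia.
split=> [fc [|x] i|gr i i0 /=].
- move=> hi; have i0 : 0 < i by move: hi; rewrite mem_colored_letters /=; lia.
  have [+ _] := fc i i0; rewrite first1 //.
  by move=> /eqP.
- move=> hi; have i0 : 0 < i by move: hi; rewrite mem_colored_letters /=; lia.
  have hx : (x.+1, i) \in colored_letters lam.
    move: hi; rewrite !mem_colored_letters /=.
    by have := partS_le hl (isT : 0 < x.+1); lia.
  have [_ /(_ x.+1)] := fc i i0; rewrite firstS // inC leqnn hx.
  by move=> /(_ isT isT) /eqP.
split=> [|x x0]; last rewrite inC leqnn /= => hx.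
  case: (boolP ((1, i) \in colored_letters lam)) => [h1|/none h1].
    by rewrite first1 //; apply/eqP/gr.
  by have := h1 i0 0; rewrite rot0.
case: (boolP ((x.+1, i) \in colored_letters lam)) => [h1|/none h1].
  by rewrite firstS //; apply/eqP; rewrite gr //; case: (x) x0.
exact: h1.
Qed.

(** * Cocharge labels and the major index *)

(** The term [f j] is counted once for each [a] with [j < a <= m], that is [m - j] times. *)
Lemma sum_partial_sums (f : nat -> nat) (m : nat) :
  \sum_(1 <= a < m.+1) \sum_(1 <= j < a) f j = \sum_(1 <= j < m) f j * (m - j).
Proof.
elim: m => [|m IH]; first by rewrite !big_geq.
rewrite big_nat_recr //= IH; case: m {IH} => [|m]; first by rewrite !big_geq.
rewrite [RHS]big_nat_recr //= subSnn muln1 [X in _ + X]big_nat_recr //= addnA.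
congr (_ + _); rewrite -big_split /=; apply: eq_big_nat => j jm.
by rewrite [m.+2 - j]subSn ?mulnS 1?addnC //; lia.
Qed.

Lemma maj_word_of (lam : seq nat) (rho : cletter -> nat) (i : nat) :
  maj (word_of lam rho i) =
  \sum_(1 <= j < conj_part lam i)
     (rho (j, i) < rho (j.+1, i)) * (conj_part lam i - j).
Proof.
rewrite /maj size_map size_iota big_mkcond /=; apply: eq_big_nat => j ji.
rewrite !nth_word_of ?prednK; try lia.
by case: ifP => _; rewrite ?mul1n ?mul0n.
Qed.

(** The label grows when a letter precedes its successor on the circle. In a common row the larger
    letter comes first, so a tie gives no growth, just as it is no ascent. *)
Lemma cocharge_labelE (lam : seq nat) (rho : cletter -> nat) (i a : nat) :
  is_partition lam -> row_bounded lam rho -> 0 < i -> a <= conj_part lam i ->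
  cocharge_label [seq z <- circle (tabloid_of lam rho) | z.2 == i] i a =
  \sum_(1 <= j < a) (rho (j, i) < rho (j.+1, i)).
Proof.
move=> hl rb i0; set s := filter _ _.
have ss : sorted (circ_lt rho) s.
  by apply: sorted_filter; [exact: circ_lt_trans|exact: circle_tabloid_of_sorted].
have ins x : 0 < x <= conj_part lam i -> (x, i) \in s.
  move=> /andP[x0 xi]; rewrite mem_filter eqxx (perm_mem (perm_circle_tabloid_of rb)).
  by rewrite mem_colored_letters /= x0 i0 -leq_conj_part.
have ltI := sorted_ltn_index (@circ_lt_trans rho) ss.
elim: a => [|[|a] IH] ai; [by rewrite big_geq | by rewrite big_geq |].
rewrite big_nat_recr // -IH; last exact: ltnW.
rewrite -[LHS]/(_ + _); congr (_ + nat_of_bool _).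
have s1 : (a.+1, i) \in s by apply: ins; lia.
have s2 : (a.+2, i) \in s by apply: ins; lia.
apply/idP/idP => [/(ltI _ _ s1 s2)|lt]; first by rewrite /circ_lt /prism_lt /=; lia.
(* Equal indices would identify two distinct letters, and the reversed order would contradict
   [lt]. *)
rewrite ltnNge leq_eqVlt; apply/negP => /orP[/eqP|/(ltI _ _ s2 s1)].
  by move=> /(congr1 (nth (0, 0) s)); rewrite !nth_index // => -[]; lia.
by rewrite /circ_lt /prism_lt /=; lia.
Qed.

Lemma cocharge_tabloid_of (lam : seq nat) (rho : cletter -> nat) :
  is_partition lam -> row_bounded lam rho ->
  cocharge lam (tabloid_of lam rho) = \sum_(w <- words_of lam rho) maj w.
Proof.
move=> hl rb; rewrite /cocharge big_map [RHS](_ : _ =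
  \sum_(1 <= i < (part lam 1).+1) maj (word_of lam rho i)); last first.
  by rewrite /index_iota subn1.
apply: eq_big_nat => i /andP[i0 _]; rewrite maj_word_of -sum_partial_sums.
by apply: eq_big_nat => a /andP[_ ai]; apply: cocharge_labelE.
Qed.

(** * The companion and its faithful recoloring *)

Lemma words_of_inj (lam : seq nat) (rho rho' : cletter -> nat) :
  is_partition lam -> words_of lam rho = words_of lam rho' ->
  {in colored_letters lam, rho =1 rho'}.
Proof.
move=> hl /eq_in_map ww [x y]; rewrite mem_colored_letters /= => /and3P[x0 y0 yx].
have y1 : y \in iota 1 (part lam 1) by rewrite mem_iota; have := part_le1 hl x0 y0 yx; lia.
have xy : x.-1 < conj_part lam y by rewrite prednK // leq_conj_part.
by rewrite -(prednK x0) -(nth_word_of rho xy) ww // nth_word_of.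
Qed.

Lemma conj_part_path (lam : seq nat) (n : nat) :
  path geq (size lam) [seq conj_part lam k | k <- iota 1 n].
Proof.
(* Every part is at least 0, so the bound is the conjugate part at 0 and joins the list. *)
have -> : size lam = conj_part lam 0 by rewrite /conj_part count_predT.
rewrite -[path _ _ _]/(sorted geq (map (conj_part lam) (iota 0 n.+1))).
apply: (homo_sorted (e := leq)); last exact: iota_sorted.
by move=> x y xy; apply: sub_count => p /=; apply: leq_trans.
Qed.

(** The cells of [b] are the colored letters of its shape, and the companion puts each of them in
    the row named by its entry. *)
Lemma companionE (lam : seq nat) (b : filling) :
  shape b = lam -> companion b = tabloid_of lam (entry b).
Proof.
move=> <-; rewrite /companion /tabloid_of; suff -> : cells b = colored_letters (shape b) by [].
rewrite /cells /colored_letters size_map; congr flatten; apply: eq_map => r.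
congr map; congr iota; rewrite /row /part.
case: (ltnP r.-1 (size b)) => rb; first by rewrite (nth_map [::]).
by rewrite !nth_default ?size_map.
Qed.

Lemma available_entry (b : filling) (x : nat) :
  available (shape b) (entry b) x 1 = row b x.
Proof.
rewrite /available subn1 /=; have -> : part (shape b) x = size (row b x).
  rewrite /part /row; case: (ltnP x.-1 (size b)) => rb; first by rewrite (nth_map [::]).
  by rewrite !nth_default ?size_map.
apply: (@eq_from_nth _ 0); rewrite size_map size_iota // => k kx.
by rewrite (nth_map 0) ?size_iota // nth_iota.
Qed.

Lemma available1 (lam : seq nat) (rho : cletter -> nat) (x : nat) :
  available lam rho x 1 = [seq rho (x, y) | y <- iota 1 (part lam x)].
Proof. by rewrite /available subn1. Qed.

Theorem proposition42 (lam : seq nat) (b : filling)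
    (hlam : is_partition lam) (hb : in_tensor lam b) :
  exists T0 : ctabloid,
    unique (is_faithful_recoloring lam (companion b)) T0 /\
    zmaj lam b = cocharge lam T0.
Proof.
case/and3P: hb => /eqP sb _ /allP bn.
have sizeb : size b = size lam by rewrite -sb size_map.
have rbb : row_bounded lam (entry b).
  move=> [x y]; rewrite mem_colored_letters /= => /and3P[x0 y0 yx].
  have : entry b (x, y) \in row b x.
    rewrite -available_entry available1 sb; apply: map_f.
    by rewrite mem_iota; lia.
  rewrite /row; case: (ltnP x.-1 (size b)) => xb; last by rewrite nth_default.
  by apply: (allP (bn _ _)); apply: mem_nth.
have hpath : path geq (size b) [seq conj_part lam k | k <- iota 1 (part lam 1)].
  by rewrite sizeb conj_part_path.
(* The columns of the words of [entry b] are literally the rows of [b], which gives their sizes. *)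
have hsize x : x < size b -> size (nth [::] b x) =
    count (fun h => x < h) [seq conj_part lam k | k <- iota 1 (part lam 1)].
  move=> xb; rewrite -(map_size_words_of lam (entry b)) count_map.
  rewrite -[nth _ _ _]/(row b x.+1) -available_entry sb.
  by rewrite -(column_words_of _ _ hlam) // drop0 size_map size_filter.
have [eW fW cW] := read_words_correct hpath hsize.
rewrite -/(zwords lam b) in eW fW cW.
(* The witness places [(x, y)] in the row named by letter [x] of word [y] of Z(b). *)
pose rho (z : cletter) := nth 0 (nth [::] (zwords lam b) z.2.-1) z.1.-1.
have wrho : words_of lam rho = zwords lam b.
  have sW : size (words_of lam rho) = size (zwords lam b).
    by rewrite -(size_map size) map_size_words_of -eW size_map.
  apply: (@eq_from_nth _ [::]) => // k kW.
  have sk : size (nth [::] (words_of lam rho) k) = size (nth [::] (zwords lam b) k).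
    by rewrite -!(nth_map _ 0) -?sW // eW map_size_words_of.
  apply: (@eq_from_nth _ 0) => // x xk.
  have kl : k < part lam 1 by move: kW; rewrite size_map size_iota.
  move: xk; rewrite (nth_map 0) ?size_iota // nth_iota // size_map size_iota.
  by move=> xk; rewrite nth_word_of.
have crho x : 0 < x -> x <= size b -> perm_eq (available lam rho x 1) (row b x).
  case: x => // x _ xb; rewrite -(column_words_of _ _ hlam) // drop0 wrho.
  exact: cW.
have avail0 r x : size b < x -> available lam r x 1 = [::].
  by move=> bx; rewrite available1 /part nth_default // -sizeb; lia.
(* For [rho] and for the companion alike, the rows of the letters [x] are a rearrangement of row [x]
   of [b]. *)
have prho x : 0 < x -> perm_eq (available lam rho x 1) (available lam (entry b) x 1).
  move=> x0; case: (leqP x (size b)) => xb; last by rewrite !avail0.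
  by rewrite -[in X in perm_eq _ X]sb available_entry crho.
have rbr : row_bounded lam rho.
  move=> [x y]; rewrite mem_colored_letters /= => /and3P[x0 y0 yx].
  have : rho (x, y) \in available lam rho x 1.
    by rewrite available1; apply: map_f; rewrite mem_iota; lia.
  rewrite (perm_mem (prho x x0)) => /mapP[y' y'x ->]; apply: rbb.
  by move: y'x; rewrite mem_iota mem_colored_letters /=; lia.
have unz : map unzip1 (tabloid_of lam rho) = map unzip1 (companion b).
  rewrite (companionE sb); apply/unzip1_tabloid_ofP => // x x0.
  by rewrite -!available1 prho.
have shapeE (T T' : ctabloid) : map unzip1 T = map unzip1 T' -> shape T = shape T'.
  move=> /(congr1 shape); rewrite /shape -!map_comp.
  by rewrite !(eq_map (g := size)) // => r; rewrite /= size_map.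
exists (tabloid_of lam rho); split; last by rewrite cocharge_tabloid_of // wrho.
split.
  split=> //; first by rewrite -(shapeE _ _ unz); apply: tabloid_of_colored.
  by apply/faithfully_coloredP => //; apply/faithful_words_ofP; rewrite ?wrho.
(* Uniqueness: the color words of [T'] are faithful with the rows of [b] as columns, so they are the
   words of Z(b). *)
move=> T' [cT uT fT].
have sT : size T' = sumn lam.
  by rewrite -(size_map unzip1) uT size_map (companionE sb) size_map size_iota.
have [rbT eT] := colored_tabloidE cT sT; set rho' := row_index T' in rbT eT.
rewrite eT; apply: eq_tabloid_of; apply: words_of_inj => //; rewrite wrho.
rewrite /zwords -(map_size_words_of lam rho'); apply/esym/read_words_unique.
- by rewrite map_size_words_of.
- move=> x xb; have := column_words_of rho' x hlam (isT : 0 < 1).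
  rewrite drop0 => ->.
  move: uT; rewrite eT (companionE sb) => /unzip1_tabloid_ofP => /(_ rbT rbb x.+1 isT).
  by rewrite -!available1 -[in X in perm_eq _ X]sb available_entry.
- by apply/faithful_words_ofP => //; apply/faithfully_coloredP => //; rewrite -eT.
Qed.
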